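(* For every perfect, claw-free graph $G$ with $n$ vertices, the stable set polytope $\operatorname{STAB}(G)$ has an extended formulation of size $O(n^3)$ (with an absolute constant hidden in $O$).
   Context: Graphs are finite, simple and undirected. $G$ is perfect if for every induced subgraph the chromatic number equals the size of a largest clique. $G$ is claw-free if no vertex has three pairwise non-adjacent neighbors. $\operatorname{STAB}(G)\subseteq\mathbb{R}^{V(G)}$ is the convex hull of the characteristic vectors of the stable (independent) sets of $G$. An extended formulation of a polytope $P\subseteq\mathbb{R}^d$ is a description of a polyhedron $Q\subseteq\mathbb{R}^e$ by linear inequalities and equations, together with a linear map $\pi:\mathbb{R}^e\to\mathbb{R}^d$ with $\pi(Q)=P$; its size is the number of inequalities (equations and variables are not counted). *)

(* Defs.v *)
From mathcomp Require Import all_boot all_order all_algebra.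
From mathcomp Require Import classical_sets reals convex.

Set Implicit Arguments.
Unset Strict Implicit.
Unset Printing Implicit Defensive.

Import Order.TTheory GRing.Theory Num.Theory.

Record sgraph := SGraph {
  vertex :> finType;
  adj : rel vertex;
  adj_sym : symmetric adj;
  adj_irrefl : irreflexive adj }.

Notation "x -- y" := (adj x y) (at level 30).

Section Graphs.
Variable G : sgraph.
Implicit Types S K U : {set G}.

Definition stable S : bool := [forall x in S, forall y in S, ~~ (x -- y)].

Definition clique K : bool :=
  [forall x in K, forall y in K, (x != y) ==> (x -- y)].

Definition clique_number : nat := \max_(K : {set G} | clique K) #|K|.

Definition colorable (k : nat) : bool :=
  [exists f : {ffun G -> 'I_k}, forall x, forall y, (x -- y) ==> (f x != f y)].

Lemma colorable_card : exists k, colorable k.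
Proof.
exists #|G|; apply/existsP; exists [ffun x => enum_rank x].
apply/forallP => x; apply/forallP => y; apply/implyP => xy.
rewrite !ffunE (inj_eq enum_rank_inj).
by apply: contraTneq xy => ->; rewrite adj_irrefl.
Qed.

Definition chromatic_number : nat := ex_minn colorable_card.

Definition claw_free : Prop :=
  forall (v : G) S, S \subset [set u | v -- u] -> stable S -> #|S| <> 3.

Definition induced_adj U : rel {x : G | x \in U} := fun x y => val x -- val y.

Lemma induced_sym U : symmetric (@induced_adj U).
Proof. by move=> x y; apply: adj_sym. Qed.

Lemma induced_irrefl U : irreflexive (@induced_adj U).
Proof. by move=> x; apply: adj_irrefl. Qed.

Definition induced U : sgraph := SGraph (@induced_sym U) (@induced_irrefl U).

End Graphs.

Definition perfect (G : sgraph) : Prop :=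
  forall U : {set G},
    chromatic_number (induced U) = clique_number (induced U).

Section Polyhedra.
Variable R : realType.
Local Open Scope classical_set_scope.
Local Open Scope ring_scope.

Definition convex_hull (E : lmodType R) (A : set E) : set E :=
  smallest (@convex_set R E) A.

(* R^o, R as a module over itself, makes {ffun G -> R^o} an lmodType R. *)
Definition char_vector (G : sgraph) (S : {set G}) : {ffun G -> R^o} :=
  [ffun v => (v \in S)%:R].

Definition STAB (G : sgraph) : set {ffun G -> R^o} :=
  convex_hull [set char_vector S | S in [set S : {set G} | stable S]].

Definition polyhedron (e m k : nat) (A : 'M[R]_(m, e)) (b : 'cV[R]_m)
    (B : 'M[R]_(k, e)) (d : 'cV[R]_k) : set 'cV[R]_e :=
  [set x | (forall i, (A *m x) i 0 <= b i 0) /\ B *m x = d].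

(* The size counts the rows of the inequality system only; ef_dim (variables)
   and ef_neqs (equations) are free. *)
Record extended_formulation (E : lmodType R) (P : set E) := ExtForm {
  ef_dim : nat;
  ef_size : nat;
  ef_neqs : nat;
  ef_ineq_lhs : 'M[R]_(ef_size, ef_dim);
  ef_ineq_rhs : 'cV[R]_ef_size;
  ef_eq_lhs : 'M[R]_(ef_neqs, ef_dim);
  ef_eq_rhs : 'cV[R]_ef_neqs;
  ef_proj : {linear 'cV[R]_ef_dim -> E};
  ef_projP :
    [set ef_proj x | x in polyhedron ef_ineq_lhs ef_ineq_rhs
                                     ef_eq_lhs ef_eq_rhs] = P }.

End Polyhedra.

Arguments STAB : clear implicits.

(* Main.v *)
Require Import Defs.
From HB Require Import structures.
From mathcomp Require Import classical_sets reals convex.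
From mathcomp Require Import all_boot all_order all_algebra.
From mathcomp Require Import interval_inference lra zify.

(* For a clique K, a vertex v of K and a stable set S, the set T = S ∩ N[v] has
   at most two elements because G is claw-free, and it determines S ∩ K. Hence
   the slack 1 - |S ∩ K| of the clique inequality is the sum over all T with
   |T| <= 2 and T ∩ K = ∅ of the indicators z_(v,T) of S ∩ N[v] = T: a
   nonnegative factorization of rank O(n^3), indexed by the pairs (v, T). As in
   Yannakakis' theorem, it yields an extended formulation whose variables are
   the z_(v,T) >= 0; the coordinate x_v is read off as z_(v,{v}).
   The clique inequalities describe STAB(G) because G is perfect: replicating
   vertices turns optimal colorings into optimal multicolorings (Lovász), which
   gives a stable set meeting all tight cliques, and a greedy subtraction of
   such stable sets writes a point as a convex combination. *)

Set Implicit Arguments.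
Unset Strict Implicit.
Unset Printing Implicit Defensive.

Import Order.TTheory GRing.Theory Num.Theory.

(** * Stable sets and cliques *)

Section StableClique.
Variable G : sgraph.
Implicit Types (S K U : {set G}) (u v : G).

Lemma stableP S : reflect {in S &, forall u v, ~~ (u -- v)} (stable S).
Proof.
apply: (iffP forall_inP) => [st u v uS vS|st u uS].
  by move/forall_inP: (st u uS); apply.
by apply/forall_inP => v vS; apply: st.
Qed.

Lemma cliqueP K : reflect {in K &, forall u v, u != v -> u -- v} (clique K).
Proof.
apply: (iffP forall_inP) => [cK u v uK vK|cK u uK].
  by move/forall_inP: (cK u uK) => /(_ v vK)/implyP.
by apply/forall_inP => v vK; apply/implyP; apply: cK.
Qed.

Lemma stable0 : stable (set0 : {set G}).
Proof. by apply/stableP => u v; rewrite inE. Qed.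

Lemma stable1 v : stable [set v].
Proof. by apply/stableP => u w /set1P-> /set1P->; rewrite adj_irrefl. Qed.

Lemma clique0 : clique (set0 : {set G}).
Proof. by apply/cliqueP => u v; rewrite inE. Qed.

Lemma clique1 v : clique [set v].
Proof. by apply/cliqueP => u w /set1P-> /set1P->; rewrite eqxx. Qed.

Lemma stableS U S : U \subset S -> stable S -> stable U.
Proof.
move=> US /stableP st; apply/stableP => u v uU vU.
by apply: st; apply: (subsetP US).
Qed.

Lemma card_stable_clique S K : stable S -> clique K -> (#|S :&: K| <= 1)%N.
Proof.
move=> /stableP st /cliqueP cK; apply/card_le1_eqP => u v.
rewrite !inE => /andP[uS uK] /andP[vS vK]; apply/eqP.
by apply: contraNT (st _ _ vS uS) => uv; apply: cK.
Qed.

Lemma card_setIE S K : #|S :&: K| = (\sum_(v in K) (v \in S))%N.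
Proof.
rewrite -sum1_card big_mkcond [RHS]big_mkcond; apply: eq_bigr => v _.
by rewrite inE andbC; case: (v \in K); case: (v \in S).
Qed.

End StableClique.

(** * Multicolorings of perfect graphs *)

Section WeightedColoring.
Variable G : sgraph.
Hypothesis perfG : perfect G.

(** Cliques of [induced U] are cliques of [G] inside [U], so perfection gives a coloring with at
    most [k] colors; empty sets pad the color classes to exactly [k]. *)
Lemma perfect_set_cover (U : {set G}) k :
  (forall K : {set G}, clique K -> (#|K :&: U| <= k)%N) ->
  exists L : seq {set G}, [/\ size L = k, all (@stable G) L &
    forall v, (\sum_(S <- L) (v \in S))%N = (v \in U)].
Proof.
move=> cliqueU.
have: (chromatic_number (induced U) <= k)%N.
  rewrite perfG; apply/bigmax_leqP => K /cliqueP cK.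
  have KU : val @: K :&: U = val @: K.
    by apply/setIidPl/subsetP => _ /imsetP[x _ ->]; apply: valP.
  rewrite -(card_imset _ val_inj) -KU; apply: cliqueU.
  apply/cliqueP => _ _ /imsetP[x xK ->] /imsetP[y yK ->].
  by rewrite (inj_eq val_inj); apply: cK.
rewrite /chromatic_number; case: ex_minnP => c /existsP[f /forallP fP] _ ck.
pose color i : {set G} := [set v | [exists x : {x | x \in U},
  (val x == v) && (f x == i)]].
exists (map color (enum 'I_c) ++ nseq (k - c) set0); split.
- by rewrite size_cat size_map size_enum_ord size_nseq subnKC.
- rewrite all_cat all_nseq stable0 orbT andbT; apply/allP => _ /mapP[i _ ->].
  apply/stableP => u v; rewrite !inE.
  move=> /existsP[x /andP[/eqP<- /eqP fx]] /existsP[y /andP[/eqP<- /eqP fy]].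
  apply/negP => xy; move/forallP/(_ y)/implyP: (fP x) => /(_ xy).
  by rewrite fx fy eqxx.
move=> v; rewrite big_cat/= big_map big_enum/=.
rewrite [X in (_ + X)%N]big1_seq; last first.
  by move=> S; rewrite mem_nseq => /andP[_ /andP[_ /eqP->]]; rewrite inE.
rewrite addn0; case: (boolP (v \in U)) => vU; last first.
  apply: big1 => i _; rewrite inE; apply/eqP; rewrite eqb0.
  by apply: contra vU => /existsP[x /andP[/eqP<- _]]; apply: valP.
pose x : {x | x \in U} := Sub v vU.
rewrite (bigD1 (f x))//= big1 => [|i ifx].
  rewrite inE addn0; apply/eqP; rewrite eqb1.
  by apply/existsP; exists x; rewrite !eqxx.
rewrite inE; apply/eqP; rewrite eqb0.
apply: contra ifx => /existsP[y /andP[/eqP yv /eqP<-]].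
by apply/eqP; congr (f _); apply: val_inj.
Qed.

(* Lovász's replication argument: if the cover of y - 1_x contains a set S
   through x, then every clique of weight k meets S, so y - 1_S can be covered
   with one set less. *)
Lemma perfect_multicover (y : G -> nat) k :
  (forall K : {set G}, clique K -> (\sum_(v in K) y v <= k)%N) ->
  exists L : seq {set G}, [/\ size L = k, all (@stable G) L &
    forall v, (\sum_(S <- L) (v \in S))%N = y v].
Proof.
have [n] := ubnP (\sum_v y v); elim: n => // n IHn in y k *.
rewrite ltnS => yn cliquey.
have [y1|] := boolP [forall v, y v <= 1]%N.
  have yE v : y v = (v \in [set v | y v == 1%N]).
    by rewrite inE; case: (y v) (forallP y1 v) => [|[|]].
  have [K cK|L [sL stL covL]] := @perfect_set_cover [set v | y v == 1%N] k.
    rewrite setIC card_setIE; apply: leq_trans (cliquey K cK).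
    by apply: leq_sum => v _; rewrite -yE.
  by exists L; split=> // v; rewrite covL -yE.
rewrite negb_forall => /existsP[x]; rewrite -ltnNge => yx.
(* As [y x >= 2], the reduced weight of [x] is still positive, so the cover of [y'] has a set
   through [x]. *)
pose y' v := (y v - (v == x))%N.
have le_y' v : (y' v <= y v)%N by exact: leq_subr.
have [||L [sL stL covL]] := IHn y' k.
- apply: leq_trans yn; rewrite (bigD1 x)//= [leqRHS](bigD1 x)//= -addSn.
  by apply: leq_add; [rewrite /y' eqxx; lia|apply: leq_sum].
- by move=> K cK; apply: leq_trans (cliquey K cK); apply: leq_sum.
have /hasP[S SL xS] : has (fun S : {set G} => x \in S) L.
  rewrite -[has _ _]negbK -all_predC; apply/negP => /allP nL.
  have : (0 < y' x)%N by rewrite /y' eqxx; lia.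
  by rewrite -covL big1_seq// => S /andP[_ /nL/= /negbTE->].
have le_S v : ((v \in S) <= y' v)%N.
  by rewrite -covL (big_rem S)//= leq_addr.
have stS := allP stL _ SL.
pose y'' v := (y v - (v \in S))%N.
have k_gt0 : (0 < k)%N by rewrite -sL; case: (L) SL.
have [||L' [sL' stL' covL']] := IHn y'' k.-1.
- apply: leq_trans yn; rewrite (bigD1 x)//= [leqRHS](bigD1 x)//= -addSn.
  apply: leq_add; first by rewrite /y'' xS; lia.
  by apply: leq_sum => v _; exact: leq_subr.
- move=> K cK; rewrite -ltnS prednK//.
  (* A clique meeting [S] loses weight. On a clique missing [S], [y''] agrees with [y'] because [x]
     is in [S], and the other [k - 1] sets of [L] contain at most one of its vertices each. *)
  have [SK0|[u]] := set_0Vmem (S :&: K); last first.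
    rewrite inE => /andP[uS uK]; apply: leq_trans (cliquey K cK).
    rewrite (bigD1 u)//= [leqRHS](bigD1 u)//= -addSn.
    apply: leq_add.
      by have := le_S u; have := le_y' u; rewrite /y'' uS; lia.
    by apply: leq_sum => v _; exact: leq_subr.
  have -> : (\sum_(v in K) y'' v = \sum_(T <- L) #|T :&: K|)%N.
    under [RHS]eq_bigr do rewrite card_setIE.
    rewrite exchange_big/=; apply: eq_bigr => v vK; rewrite covL /y'' /y'.
    have /negbTE vS : v \notin S.
      by apply/negP => vS; move/setP/(_ v): SK0; rewrite !inE vS vK.
    by rewrite vS; case: eqP => // vx; rewrite -vx vS in xS.
  rewrite (big_rem S)//= SK0 cards0 add0n -{}sL.
  have sr : (size (rem S L)).+1 = size L.
    by rewrite size_rem// prednK//; case: (L) SL.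
  rewrite -sr ltnS -sum1_size; rewrite !big_seq.
  apply: leq_sum => T /mem_rem TL.
  by apply: card_stable_clique => //; exact: (allP stL).
exists (S :: L'); split=> /=; first by rewrite sL' prednK.
  by rewrite stS.
by move=> v; rewrite big_cons covL' /y''; have := le_S v; have := le_y' v; lia.
Qed.

End WeightedColoring.

(** * Simultaneous Diophantine approximation *)

Local Open Scope ring_scope.

(** Pigeonhole: among [N ^ #|I| + 1] multiples of [x], two have all their fractional parts in the
    same intervals of length [1 / N]; [q] is the difference of the multipliers. The last conclusion
    keeps the rounded weights inside the support of [x]. *)
Lemma dirichlet_approximation (R : archiRealFieldType) (I : finType)
    (x : I -> R) (N : nat) : (0 < N)%N -> (forall i, 0 <= x i) ->
  exists (q : nat) (y : I -> nat), [/\ (0 < q)%N,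
    forall i, N%:R * `|q%:R * x i - (y i)%:R| < 1 &
    forall i, x i = 0 -> y i = 0%N].
Proof.
case: N => // N _ x0; pose t (j : nat) i := Num.truncn (j%:R * N.+1%:R * x i).
pose bucket (j : 'I_#|{ffun I -> 'I_N.+1}|.+1) : {ffun I -> 'I_N.+1} :=
  [ffun i => Ordinal (ltn_pmod (t j i) (ltn0Sn N))].
have /injectivePn[j1 [j2]] : ~~ injectiveb bucket.
  by apply/injectiveP => /leq_card; rewrite card_ord ltnn.
wlog j12 : j1 j2 / (j1 < j2)%N.
  move=> wh nj eb; have [jlt|jlt|/val_inj je] := ltngtP j1 j2.
  - exact: (wh j1 j2).
  - by apply: (wh j2 j1) => //; rewrite eq_sym.
  - by rewrite je eqxx in nj.
move=> _ /ffunP eb.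
have te i : t j1 i = t j2 i %[mod N.+1].
  by have := eb i; rewrite !ffunE => -[].
have t12 i : (t j1 i <= t j2 i)%N.
  apply: le_truncn; rewrite -!mulrA ler_wpM2r ?mulr_ge0// ler_nat.
  exact: ltnW.
exists (j2 - j1)%N, (fun i => (t j2 i - t j1 i) %/ N.+1)%N; split.
- by rewrite subn_gt0.
- move=> i; have dN : (N.+1 %| t j2 i - t j1 i)%N by rewrite -eqn_mod_dvd// te.
  rewrite -[N.+1%:R]ger0_norm// -normrM mulrBr -natrM mulnC divnK// mulrC.
  rewrite !natrB ?(ltnW j12)//.
  have ge0 (j : nat) : 0 <= j%:R * N.+1%:R * x i :> R by rewrite !mulr_ge0.
  have /andP[] := truncn_itv (ge0 j1); have /andP[] := truncn_itv (ge0 j2).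
  rewrite -/(t j1 i) -/(t j2 i) -!natr1; move: (t j1 i)%:R (t j2 i)%:R => t1 t2.
  by rewrite ltr_norml; lra.
- by move=> i xi; rewrite /t xi !mulr0 truncn0 subnn div0n.
Qed.

Lemma convex_set_comb (R : realType) (E : lmodType R) (C : set E) (x y : E)
    (l : R) :
  convex_set C -> C x -> C y -> 0 <= l -> l <= 1 -> C (l *: x + (1 - l) *: y).
Proof.
move=> cC Cx Cy l0 l1.
by have := cC x y (Itv01 l0 l1) (mem_set Cx) (mem_set Cy) => /set_mem.
Qed.

(** * Clique inequalities describe the stable set polytope *)

Section CliquePolytope.
Variables (R : realType) (G : sgraph).
Hypothesis perfG : perfect G.
Implicit Types (S K : {set G}) (v : G) (x : {ffun G -> R^o}).

(* Rounding q x to integer weights y keeps every tight clique at weight exactly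
   q and every other one at weight at most q; each set of a cover of y by q
   stable sets then meets all tight cliques. *)
Lemma stable_meets_tight x : (forall v, 0 <= x v) ->
  (forall K, clique K -> \sum_(v in K) x v <= 1) ->
  exists S, [/\ stable S, forall v, v \in S -> x v != 0 &
    forall K, clique K -> \sum_(v in K) x v = 1 -> S :&: K != set0].
Proof.
move=> x0 xK.
(* With errors below [1 / (#|G| + 1)] per vertex, the error over any vertex set stays below 1. *)
have [q [y [q0 yq y0]]] := dirichlet_approximation (ltn0Sn #|G|) x0.
have near K : `|q%:R * (\sum_(v in K) x v) - (\sum_(v in K) y v)%:R| < 1 :> R.
  rewrite mulr_sumr natr_sum -sumrB.
  apply: le_lt_trans (ler_norm_sum _ _ _) _.
  apply: (@le_lt_trans _ _ (\sum_(v in K) #|G|.+1%:R^-1)).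
    apply: ler_sum => v _; rewrite -[leRHS]mul1r ler_pdivlMr ?ltr0Sn// mulrC.
    exact: ltW.
  rewrite sumr_const -[_ *+ _]mulr_natl ltr_pdivrMr ?ltr0Sn// mul1r ltr_nat.
  rewrite ltnS.
  exact: max_card.
have [|L [sL stL covL]] := @perfect_multicover G perfG y q.
  move=> K cK; rewrite -ltnS -(ltr_nat R) -natr1.
  have := near K; rewrite ltr_norml => /andP[+ _].
  have : q%:R * (\sum_(v in K) x v) <= q%:R by rewrite ler_piMr ?xK.
  lra.
case: L => [|S L] in sL stL covL *; first by rewrite -sL in q0.
exists S; split; first by case/andP: stL.
  move=> v vS; apply/eqP => /y0; rewrite -covL big_cons vS; lia.
move=> K cK K1; apply/eqP => SK0.
(* Only the [q - 1] other sets could cover [K], each at most once, but a tight [K] has rounded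
   weight above [q - 1]. *)
have yK : (\sum_(v in K) y v < q)%N.
  have -> : (\sum_(v in K) y v = \sum_(T <- S :: L) #|T :&: K|)%N.
    under [RHS]eq_bigr do rewrite card_setIE.
    by rewrite exchange_big/=; apply: eq_bigr => v vK; rewrite covL.
  rewrite big_cons SK0 cards0 add0n -sL /= ltnS -sum1_size !big_seq.
  apply: leq_sum => T TL; apply: card_stable_clique => //.
  by case/andP: stL => _ /allP; apply.
have := near K; rewrite K1 mulr1 ltr_norml => /andP[_].
move: yK; rewrite -(ler_nat R) -natr1; lra.
Qed.

(* Subtract the largest feasible multiple of such a stable set and rescale:
   a new coordinate vanishes or a new clique becomes tight. *)
Lemma clique_polytope_sub (C : set {ffun G -> R^o}) x :
  convex_set C -> (forall S, stable S -> C (char_vector R S)) ->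
  (forall v, 0 <= x v) -> (forall K, clique K -> \sum_(v in K) x v <= 1) -> C x.
Proof.
move=> cC CS.
(* The induction measure counts non-tight cliques and nonzero coordinates. *)
pose slack x := [set K : {set G} | clique K & \sum_(v in K) x v != 1].
pose supp x := [set v | x v != 0].
have [n] := ubnP (#|slack x| + #|supp x|); elim: n => // n IHn in x *.
rewrite ltnS => xn x0 xK.
have [S [stS Sx tS]] := stable_meets_tight x0 xK.
(* The constraints bounding the multiple [l] of the vector of [S]: cliques missing [S], and vertices
   of [S]. Cliques meeting [S] impose none, as both sides drop by [l]. The empty clique gives
   [l <= 1]. *)
pose P (i : {set G} + G) :=
  match i with inl K => clique K && (S :&: K == set0) | inr v => v \in S end.
pose F (i : {set G} + G) : R :=
  match i with inl K => 1 - \sum_(v in K) x v | inr v => x v end.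
have P0 : P (inl set0) by rewrite /= clique0 setI0 eqxx.
have [i Pi Fi] : exists2 i, P i & forall j, P j -> F i <= F j.
  by case: (arg_minP F P0) => i; exists i.
pose l := F i.
have l0 : 0 <= l.
  by rewrite /l; case: (i) Pi => [K /andP[cK _]|v _] /=; rewrite ?subr_ge0 ?xK.
have l1 : l <= 1 by have := Fi _ P0; rewrite /= big_set0 subr0.
have lS v : v \in S -> l <= x v by exact: (Fi (inr v)).
have lK K : clique K -> S :&: K = set0 -> \sum_(v in K) x v <= 1 - l.
  move=> cK SK; have := Fi (inl K); rewrite /= cK SK eqxx => /(_ isT).
  by rewrite -/l; lra.
have sumS K : clique K -> \sum_(v in K) (x v - l * (v \in S)%:R) =
    \sum_(v in K) x v - l * (S :&: K != set0)%:R.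
  move=> cK; rewrite sumrB -mulr_sumr -natr_sum -card_setIE -cards_eq0.
  by case: #|_| (card_stable_clique stS cK) => [|[|]].
have xlS v : 0 <= x v - l * (v \in S)%:R.
  by case: (boolP (v \in S)) => vS; rewrite ?mulr1 ?mulr0 ?subr0 ?subr_ge0 ?lS.
have xlK K : clique K -> \sum_(v in K) (x v - l * (v \in S)%:R) <= 1 - l.
  move=> cK; rewrite sumS//; have [SK|SK] := eqVneq (S :&: K) set0.
    by rewrite mulr0 subr0 lK.
  by rewrite mulr1 lerD2r xK.
(* Rescaling would divide by 0 here; singleton cliques force [x] to be the vector of [S]. *)
have [le1|l_neq1] := eqVneq l 1.
  suff -> : x = char_vector R S by exact: CS.
  apply/ffunP => v; rewrite ffunE; have := xlS v; have := xlK _ (clique1 v).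
  by rewrite big_set1 le1; lra.
have l_lt1 : 0 < 1 - l by rewrite subr_gt0 lt_neqAle l_neq1.
pose x' : {ffun G -> R^o} := [ffun v => (x v - l * (v \in S)%:R) / (1 - l)].
have x'K K : \sum_(v in K) x' v =
    (\sum_(v in K) (x v - l * (v \in S)%:R)) / (1 - l).
  by rewrite mulr_suml; apply: eq_bigr => v _; rewrite ffunE.
have Cx' : C x'.
  apply: IHn; last 2 first.
  - by move=> v; rewrite ffunE divr_ge0// ltW.
  - by move=> K cK; rewrite x'K ler_pdivrMr// mul1r xlK.
  apply: leq_trans xn.
  have supp' : supp x' \subset supp x.
    apply/subsetP => v; rewrite !inE; apply: contraNN => /eqP xv.
    rewrite ffunE xv; case: (boolP (v \in S)) => [/Sx|_].
      by rewrite xv eqxx.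
    by rewrite mulr0 subr0 mul0r.
  have slack' : slack x' \subset slack x.
    apply/subsetP => K; rewrite !inE => /andP[cK]; rewrite cK.
    apply: contraNN => /eqP K1.
    rewrite x'K sumS// K1 (tS _ cK K1) mulr1 divff//.
    exact: lt0r_neq0.
  have [[K [cK SK0 lE]]|[v vS lE]] :
      (exists K, [/\ clique K, S :&: K = set0 & l = 1 - \sum_(v in K) x v]) \/
      (exists2 v, v \in S & l = x v).
    rewrite /l; case: (i) Pi => [K /andP[cK /eqP SK0]|v vS]; [left|right].
      by exists K.
    by exists v.
  - rewrite -addSn leq_add ?subset_leq_card//; apply: proper_card.
    apply/properP; split=> //; exists K; rewrite !inE cK/=.
      by apply/eqP => /(tS _ cK); rewrite SK0 eqxx.
    rewrite negbK x'K sumS// SK0 eqxx mulr0 subr0 lE subKr divff//.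
    by apply: contraNneq l_neq1; rewrite lE => ->; rewrite subr0.
  - rewrite -addnS leq_add ?subset_leq_card//; apply: proper_card.
    apply/properP; split=> //; exists v; rewrite !inE; first exact: Sx.
    by rewrite negbK ffunE vS mulr1 lE subrr mul0r.
have -> : x = l *: char_vector R S + (1 - l) *: x'.
  apply/ffunP => v.
  rewrite !ffunE -[_ *: _]/(l * _) -[(1 - l) *: _]/((1 - l) * _).
  by rewrite mulrC [(1 - l) * _]mulrC divfK ?lt0r_neq0//; lra.
by apply: convex_set_comb => //; apply: CS.
Qed.
End CliquePolytope.

(** * Neighborhoods in claw-free graphs and the index count *)

Section ClawFree.
Variable G : sgraph.
Implicit Types (S K T : {set G}) (v : G).

Definition closed_nbhd v : {set G} := [set u | (u == v) || v -- u].

Lemma clique_sub_closed_nbhd K v :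
  clique K -> v \in K -> K \subset closed_nbhd v.
Proof.
move=> /cliqueP cK vK; apply/subsetP => u uK; rewrite inE -implyNb eq_sym.
by apply/implyP; apply: cK.
Qed.

Lemma stable_closed_nbhd S v :
  stable S -> v \in S -> S :&: closed_nbhd v = [set v].
Proof.
move=> /stableP st vS; apply/setP => u; rewrite !inE.
have [->|_] := eqVneq u v; first by rewrite vS.
by apply/negP => /andP[uS vu]; have := st _ _ vS uS; rewrite [v -- u]vu.
Qed.

(** If [v] is not in [S], three elements would be pairwise non-adjacent neighbors of [v]; if it is,
    only [v] remains. *)
Lemma claw_free_card S v :
  claw_free G -> stable S -> (#|S :&: closed_nbhd v| <= 2)%N.
Proof.
move=> cf stS; have [vS|vS] := boolP (v \in S).
  by rewrite stable_closed_nbhd ?cards1.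
rewrite leqNgt; apply/negP => /card_geqP[s [us ss sS]].
have sub u : u \in [set:: s] -> (u \in S) && (v -- u).
  rewrite inE => /sS; rewrite !inE => /andP[uS]; rewrite uS/=.
  by case: eqP => // uv; rewrite -uv uS in vS.
apply: (cf v [set:: s]).
- by apply/subsetP => u /sub/andP[_ vu]; rewrite inE.
- by apply: stableS stS; apply/subsetP => u /sub/andP[].
- by rewrite cardsE (card_uniqP us).
Qed.

Definition small_set_index : finType :=
  {p : G * {set G} | (#|p.2| <= 2)%N}.

(** These pairs index equations, so their possibly exponential number does not affect the size. *)
Definition clique_index : finType :=
  {p : G * {set G} | clique p.2 && (p.1 \in p.2)}.

Lemma card_small_sets : (#|[set T : {set G} | (#|T| <= 2)%N]| <= #|G|.+1 ^ 2)%N.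
Proof.
(* [None] stands for a missing element. *)
pose f (p : option G * option G) :=
  [set u | (Some u == p.1) || (Some u == p.2)].
suff sub : [set T : {set G} | (#|T| <= 2)%N] \subset f @: setT.
  apply: leq_trans (subset_leq_card sub) _.
  apply: leq_trans (leq_imset_card _ _) _.
  by rewrite cardsT card_prod !card_option mulnn.
apply/subsetP => T; rewrite inE => T2.
suff [p ->] : exists p, T = f p by apply: imset_f; rewrite inE.
move: T2; rewrite leq_eqVlt ltnS leq_eqVlt ltnS leqn0 => /or3P[].
- move=> /cards2P[u [v [_ ->]]]; exists (Some u, Some v).
  by apply/setP => w; rewrite !inE !(inj_eq Some_inj).
- move=> /cards1P[u ->]; exists (Some u, Some u).
  by apply/setP => w; rewrite !inE !(inj_eq Some_inj) orbb.
- rewrite cards_eq0 => /eqP->; exists (None, None).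
  by apply/setP => w; rewrite !inE.
Qed.

Lemma card_small_set_index : (#|small_set_index| <= 4 * #|G| ^ 3)%N.
Proof.
have -> : #|small_set_index| = (#|G| * #|[set T : {set G} | (#|T| <= 2)%N]|)%N.
  rewrite card_sig -[X in (X * _)%N]cardsT -cardsX; apply: eq_card => p.
  by rewrite !inE.
apply: leq_trans (leq_mul (leqnn _) card_small_sets) _.
(* The factor 4 comes from [n + 1 <= 2 * n] for positive [n]. *)
case: #|G| => [|n]; [by rewrite mul0n|nia].
Qed.

Lemma singleton_index_subproof v : (#|(v, [set v]).2| <= 2)%N.
Proof. by rewrite cards1. Qed.

Definition singleton_index v : small_set_index :=
  Sub (v, [set v]) (singleton_index_subproof v).

End ClawFree.

(** * The extended formulation *)

Lemma polyhedron_convex (R : realType) (e m k : nat) (A : 'M[R]_(m, e))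
    (b : 'cV[R]_m) (B : 'M[R]_(k, e)) (d : 'cV[R]_k) :
  convex_set (polyhedron A b B d).
Proof.
move=> x y l /set_mem[xA xB] /set_mem[yA yB]; apply: mem_set.
change (polyhedron A b B d (l%:num *: x + (1 - l%:num) *: y)).
split=> [i|]; rewrite mulmxDr -!scalemxAr; last first.
  by rewrite xB yB -scalerDl addrC subrK scale1r.
have -> : b i 0 = l%:num * b i 0 + (1 - l%:num) * b i 0.
  by rewrite -mulrDl subrKC mul1r.
rewrite mxE [in leLHS]mxE [X in _ + X <= _]mxE.
by apply: lerD; apply: ler_wpM2l; rewrite ?subr_ge0.
Qed.

Section ExtendedFormulation.
Variables (R : realType) (G : sgraph).
Implicit Types (S K : {set G}) (v : G).
Local Notation I := (small_set_index G).
Local Notation J := (clique_index G).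

(** In row [(v, K)] the first summand selects the variables adding up to the slack of [K], the
    second the coordinates [x_u] for [u] in [K]; the row equates their total to 1. *)
Definition clique_coef (r : J) (i : I) : R :=
  (((val i).1 == (val r).1) && ((val r).2 :&: (val i).2 == set0))%:R +
  (((val i).1 \in (val r).2) && ((val i).2 == [set (val i).1]))%:R.

Definition clique_mx : 'M[R]_(#|J|, #|I|) :=
  \matrix_(r, c) clique_coef (enum_val r) (enum_val c).

Definition singleton_proj (z : 'cV[R]_#|I|) : {ffun G -> R^o} :=
  [ffun v => z (enum_rank (singleton_index v)) 0].

Lemma singleton_proj_is_linear : linear singleton_proj.
Proof. by move=> a y z; apply/ffunP => v; rewrite !ffunE !mxE. Qed.

HB.instance Definition _ := GRing.isLinear.Build R 'cV[R]_#|I| {ffun G -> R^o}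
  *:%R singleton_proj singleton_proj_is_linear.

Definition clique_polyhedron :=
  polyhedron (- 1%:M : 'M[R]_#|I|) 0 clique_mx (const_mx 1).

Lemma sum_singleton_index (K : {set G}) (f : I -> R) :
  \sum_i (((val i).1 \in K) && ((val i).2 == [set (val i).1]))%:R * f i =
  \sum_(u in K) f (singleton_index u).
Proof.
transitivity (\sum_(i : I | ((val i).1 \in K) &&
    ((val i).2 == [set (val i).1])) f i).
  rewrite [RHS]big_mkcond; apply: eq_bigr => i _.
  by case: ifP; rewrite ?mul1r ?mul0r.
rewrite (reindex_onto (@singleton_index G) (fun i : I => (val i).1))/=.
  by apply: eq_bigl => u; rewrite !eqxx !andbT.
move=> i /andP[_ /eqP iT]; apply: val_inj.
by rewrite /= [RHS]surjective_pairing iT.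
Qed.

Lemma clique_polyhedronP z : clique_polyhedron z <->
  (forall i : I, 0 <= z (enum_rank i) 0) /\
  (forall r : J, \sum_(i | ((val i).1 == (val r).1) &&
      ((val r).2 :&: (val i).2 == set0)) z (enum_rank i) 0 +
    \sum_(u in (val r).2) singleton_proj z u = 1).
Proof.
have ineqE c : ((- 1%:M *m z) c 0 <= (0 : 'cV[R]_#|I|) c 0) = (0 <= z c 0).
  by rewrite mulNmx mul1mx !mxE oppr_le0.
have eqnE (r : J) : (clique_mx *m z) (enum_rank r) 0 =
    \sum_(i | ((val i).1 == (val r).1) &&
      ((val r).2 :&: (val i).2 == set0)) z (enum_rank i) 0 +
    \sum_(u in (val r).2) singleton_proj z u.
  under [X in _ + X]eq_bigr do rewrite ffunE.
  rewrite -(sum_singleton_index _ (fun i => z (enum_rank i) 0)) big_mkcond.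
  rewrite -big_split mxE.
  rewrite (reindex_onto (@enum_rank I) (@enum_val I I))/=; last first.
    by move=> c _; apply: enum_valK.
  apply: eq_big => [i|i _]; first by rewrite enum_rankK eqxx.
  by rewrite mxE !enum_rankK mulrDl; case: ifP; rewrite ?mul1r ?mul0r.
split=> [[z0 /colP zK]|[z0 zK]].
  split=> [i|r]; first by rewrite -ineqE.
  by rewrite -eqnE zK mxE.
split=> [c|]; first by rewrite ineqE -[c]enum_valK.
by apply/colP => r; rewrite -[r]enum_valK eqnE zK mxE.
Qed.

(** Each row writes the slack of a clique as a sum of nonnegative variables, which gives its
    inequality. The empty clique has no row and is treated apart. *)
Lemma singleton_proj_STAB z :
  perfect G -> clique_polyhedron z -> STAB R G (singleton_proj z).
Proof.
move=> perfG /clique_polyhedronP[z0 zK] C [cC CS].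
apply: (clique_polytope_sub perfG cC) => [S stS|v|K cK].
- by apply: CS; exists S.
- by rewrite ffunE.
- have [->|[v vK]] := set_0Vmem K; first by rewrite big_set0 ler01.
  have rK : clique (v, K).2 && ((v, K).1 \in (v, K).2) by rewrite cK.
  by rewrite -(zK (Sub (v, K) rK)) lerDr sumr_ge0.
Qed.

(** For each [v] exactly one [T] equals the trace of [S] on [closed_nbhd v], and claw-freeness makes
    it an index. As [K] lies in that neighborhood, the slack part of row [(v, K)] is 1 exactly when
    [S] misses [K]. *)
Lemma char_vector_lift S : claw_free G -> stable S ->
  exists2 z, clique_polyhedron z & singleton_proj z = char_vector R S.
Proof.
move=> cf stS.
pose z : 'cV[R]_#|I| := \col_c
  (S :&: closed_nbhd (val (enum_val c)).1 == (val (enum_val c)).2)%:R.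
have zE (i : I) :
    z (enum_rank i) 0 = (S :&: closed_nbhd (val i).1 == (val i).2)%:R.
  by rewrite mxE enum_rankK.
have pz : singleton_proj z = char_vector R S.
  apply/ffunP => v; rewrite !ffunE zE/=; congr (_%:R).
  have [vS|vS] := boolP (v \in S); first by rewrite stable_closed_nbhd ?eqxx.
  apply/eqP; rewrite eqb0; apply/eqP => /setP/(_ v).
  by rewrite !inE (negbTE vS) eqxx.
exists z => //; apply/clique_polyhedronP; split=> [i|[[v K] /= /andP[cK vK]]].
  by rewrite zE ler0n.
pose i0 : I := Sub (v, S :&: closed_nbhd v) (claw_free_card v cf stS).
have SK : K :&: (S :&: closed_nbhd v) = S :&: K.
  by rewrite setICA (setIidPl (clique_sub_closed_nbhd cK vK)).
have -> : \sum_(u in K) singleton_proj z u = (#|S :&: K|)%:R.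
  by rewrite pz card_setIE natr_sum; apply: eq_bigr => u _; rewrite ffunE.
rewrite big_mkcond (bigD1 i0)//= [X in _ + X + _]big1 => [|i ii0].
  rewrite eqxx SK addr0 zE/= eqxx -cards_eq0.
  by case: #|_| (card_stable_clique stS cK) => [|[|]]//=; rewrite ?addr0 ?add0r.
case: ifP => // /andP[/eqP iv _]; rewrite zE iv; case: eqP => // Si.
by case/eqP: ii0; apply: val_inj; rewrite /= [LHS]surjective_pairing iv -Si.
Qed.

(** A linear image of a convex set is convex, and this one contains every generator of the hull. *)
Lemma STAB_sub_proj : claw_free G ->
  (STAB R G `<=` [set singleton_proj z | z in clique_polyhedron])%classic.
Proof.
move=> cf; apply: smallest_sub => [x y l /set_mem[z zP <-] /set_mem[w wP <-]|].
  apply: mem_set; exists (l%:num *: z + (1 - l%:num) *: w).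
    by apply: convex_set_comb => //; apply: polyhedron_convex.
  by rewrite linearP [X in _ + X]linearZ.
by move=> _ [S stS <-]; have [z zP <-] := char_vector_lift cf stS; exists z.
Qed.

End ExtendedFormulation.

Theorem proposition1 (R : realType) :
  exists C : nat, forall G : sgraph, perfect G -> claw_free G ->
    exists F : extended_formulation (STAB R G), (ef_size F <= C * #|G| ^ 3)%N.
Proof.
exists 4 => G perfG cf.
have projP :
    [set singleton_proj z | z in @clique_polyhedron R G]%classic = STAB R G.
  apply/seteqP; split; last exact: STAB_sub_proj.
  by move=> _ [z zP <-]; apply: singleton_proj_STAB.
exists (ExtForm (ef_proj := @singleton_proj R G) projP).
exact: card_small_set_index.
Qed.
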